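(* Let $m\ge1$ be an integer and let $w\in L^1(0,1)$. For every cumulative distribution function $G$ on $\mathbb{R}$ with finite mean, $$T_w\bigl(\mathcal H_m(G)\bigr)=T_{P_m[w]}(G).$$
   Context: For a CDF $G$, $G^{-1}(u)=\inf\{x:G(x)\ge u\}$. For a weight function $w$ and a CDF $G$ with finite mean such that $G^{-1}w\in L^1(0,1)$, the $L$-functional is $T_w(G)=\int_0^1 G^{-1}(u)w(u)\,du$. For $1\le j\le m$, $F_{B_{j:m}}$ and $f_{B_{j:m}}$ are the CDF and density of the Beta$(j,m-j+1)$ distribution on $[0,1]$; $\mu_{j:m}(G)=\int_0^1 G^{-1}\,dF_{B_{j:m}}$; and $\mathcal H_m(G)=\frac1m\sum_{j=1}^m\mathbf 1\{\mu_{j:m}(G)\le\cdot\}$. The linear operator $P_m:L^1(0,1)\to L^1(0,1)$ is $P_m[w](u)=\sum_{j=1}^m f_{B_{j:m}}(u)\int_{(j-1)/m}^{j/m}w(t)\,dt$, $u\in[0,1]$. *)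

(* Defs.v *)
From HB Require Import structures.
From mathcomp Require Import all_boot all_order all_algebra.
From mathcomp Require Import all_classical all_reals all_analysis.

Set Implicit Arguments.
Unset Strict Implicit.
Unset Printing Implicit Defensive.

Import Order.TTheory GRing.Theory Num.Theory.
Import numFieldNormedType.Exports.

Local Open Scope classical_set_scope.
Local Open Scope ring_scope.

Notation cdfType R := (cumulativeBounded (0 : R) (1 : R)).

Section L_functionals.
Context {R : realType}.
Implicit Types (G : cdfType R) (w : R -> R) (m j : nat) (u x : R).

Local Notation mu := (@lebesgue_measure R).

Definition finite_mean G : Prop :=
  (lebesgue_stieltjes_measure G).-integrable setT (fun x : R => x%:E).

(* Elements of L^1(0,1) are represented by functions on R of which only the
   values on ]0, 1[ matter. *)
Definition L1_01 w : Prop := mu.-integrable `]0, 1[ (EFin \o w).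

(* Meaningful for 0 < u < 1, where the set is nonempty and bounded below. *)
Definition quantile G u : R := inf [set x | u <= G x].

(* Domain of the partial functional T_w. *)
Definition in_Lfunctional_domain w G : Prop :=
  finite_mean G /\ L1_01 (fun u => quantile G u * w u).

Definition Lfunctional w G : R :=
  \int[mu]_(u in `]0, 1[) (quantile G u * w u).

Definition mean_order_stat j m G : R :=
  \int[beta_prob j (m - j + 1)]_(u in `]0, 1[) quantile G u.

Definition mean_order_stat_cdf_fun m G x : R :=
  m%:R^-1 * \sum_(1 <= j < m.+1) (mean_order_stat j m G <= x)%R%:R.

Definition P_op m w u : R :=
  \sum_(1 <= j < m.+1)
    beta_pdf j (m - j + 1) u *
    \int[mu]_(t in `](j%:R - 1) / m%:R, j%:R / m%:R[) w t.

Lemma L1_01_P_op m w : L1_01 (P_op m w).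
Proof.
rewrite /L1_01 /P_op.
have -> : EFin \o (fun u => \sum_(1 <= j < m.+1) beta_pdf j (m - j + 1) u *
    \int[mu]_(t in `](j%:R - 1) / m%:R, j%:R / m%:R[) w t) =
  (fun u => \sum_(j <- index_iota 1 m.+1) (beta_pdf j (m - j + 1) u *
    \int[mu]_(t in `](j%:R - 1) / m%:R, j%:R / m%:R[) w t)%:E)%E.
  by apply/funext => u /=; rewrite sumEFin.
apply: integrable_sum => //= j _.
have hb : mu.-integrable `]0, 1[ (EFin \o beta_pdf j (m - j + 1)).
  by apply: (integrableS measurableT) => //; exact: integrable_beta_pdf.
set c := Rintegral _ _ _.
by apply: eq_integrable (integrableZr _ c hb).
Qed.

Let step (a x : R) : R := (a <= x)%R%:R.

Let step_nd a : nondecreasing (step a).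
Proof.
move=> x y xy; rewrite /step ler_nat.
by case: (leP a x) => // /le_trans/(_ xy) ->.
Qed.

Let step_rc a : right_continuous (step a).
Proof.
move=> x; apply: cvg_near_cst.
case: (leP a x) => ax; near=> y; rewrite /step; congr (_%:R); congr nat_of_bool.
  by rewrite ax; apply/(le_trans ax)/ltW.
by rewrite (lt_geF ax); apply/negbTE; rewrite -ltNge; near: y; exact: nbhs_right_lt.
Unshelve. all: by end_near. Qed.

Let step_Ny a : step a @ -oo --> (0 : R).
Proof.
apply: cvg_near_cst; near=> x; rewrite /step lt_geF//.
by near: x; apply: nbhs_ninfty_lt; rewrite num_real.
Unshelve. all: by end_near. Qed.

Let step_y a : step a @ +oo --> (1 : R).
Proof.
apply: cvg_near_cst; near=> x; rewrite /step (_ : a <= x = true)//.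
by near: x; apply: nbhs_pinfty_ge; rewrite num_real.
Unshelve. all: by end_near. Qed.

Let H_nd m G : nondecreasing (mean_order_stat_cdf_fun m G).
Proof.
move=> x y xy; rewrite ler_wpM2l ?invr_ge0// ler_sum// => j _.
exact: step_nd.
Qed.

Let H_lim m G (F : set_system R) (FF : Filter F) (l : R) :
  (forall a, step a x @[x --> F] --> l) ->
  mean_order_stat_cdf_fun m G @ F --> m%:R^-1 * \sum_(1 <= j < m.+1) l.
Proof.
move=> h; apply: cvgM; first exact: cvg_cst.
by apply: cvg_big => [|j _]; [exact: add_continuous|exact: h].
Qed.

Let H_rc m G : right_continuous (mean_order_stat_cdf_fun m G).
Proof.
move=> x; apply: cvgM; first exact: cvg_cst.
by apply: cvg_big => [|j _]; [exact: add_continuous|exact: step_rc].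
Qed.

HB.instance Definition _ m G :=
  isCumulative.Build R _ R (mean_order_stat_cdf_fun m G) (@H_nd m G) (@H_rc m G).

Let H_Ny m G : mean_order_stat_cdf_fun m G @ -oo --> (0 : R).
Proof.
rewrite -[X in _ --> X](mulr0 m%:R^-1) -[X in _ * X](@big1_eq R 0 +%R _ (index_iota 1 m.+1) xpredT).
exact: H_lim.
Qed.

Let H_y m G : (0 < m)%N -> mean_order_stat_cdf_fun m G @ +oo --> (1 : R).
Proof.
move=> m0; rewrite (_ : (1 : R) = m%:R^-1 * \sum_(1 <= j < m.+1) 1); first exact: H_lim.
by rewrite sumr_const_nat subn1/= mulVf// pnatr_eq0 -lt0n.
Qed.

Definition mean_order_stat_cdf m (m_gt0 : (0 < m)%N) G : cdfType R :=
  HB.pack (mean_order_stat_cdf_fun m G)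
    (isCumulativeBounded.Build R 0 1 (mean_order_stat_cdf_fun m G)
      (@H_Ny m G) (@H_y m G m_gt0)).

Lemma mean_order_stat_cdfE m (m_gt0 : (0 < m)%N) G x :
  mean_order_stat_cdf m_gt0 G x =
  m%:R^-1 * \sum_(1 <= j < m.+1) (mean_order_stat j m G <= x)%R%:R.
Proof. by []. Qed.

End L_functionals.

(* Main.v *)
Require Import Defs.
From mathcomp Require Import all_boot all_order all_algebra.
From mathcomp Require Import all_classical all_reals all_analysis.
From mathcomp Require Import measurable_realfun ring lra zify.

(** The means mu_j of the order statistics are nondecreasing in j: the
    difference of two consecutive Beta densities changes sign once, from
    negative to positive, and the quantile function is nondecreasing. Hence the
    quantile function of H_m(G) equals mu_j on ](j-1)/m, j/m], and both sides of
    the identity are the sum over j of mu_j times the integral of w over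
    ](j-1)/m, j/m[. The quantile function is integrable because it pushes the
    uniform distribution on ]0, 1[ forward to the law G, which has finite
    mean. *)

Set Implicit Arguments.
Unset Strict Implicit.
Unset Printing Implicit Defensive.

Import Order.TTheory GRing.Theory Num.Theory.
Import numFieldNormedType.Exports.

Local Open Scope classical_set_scope.
Local Open Scope ring_scope.

(** * The quantile function and its law under the uniform distribution *)

Section quantile.
Context {R : realType}.
Implicit Types (G : cdfType R) (u x : R).
Local Notation mu := (@lebesgue_measure R).

(** For [0 < u < 1] the limits of [G] at both infinities make the set nonempty and bounded below;
    right continuity makes its infimum attained. *)
Lemma quantile_le G u x : 0 < u < 1 -> (quantile G u <= x) = (u <= G x).
Proof.
move=> /andP[u0 u1].
have Su : [set x | u <= G x] !=set0.
  have [y [_ yG]] : \forall y \near +oo, u <= G y.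
    exact: (cvgr_ge _ (cumulativey G)).
  by exists (y + 1); apply: yG; rewrite ltrDl.
have Sl : has_lbound [set x | u <= G x].
  have [y [_ yG]] : \forall y \near -oo, G y < u.
    exact: (cvgr_lt _ (cumulativeNy G)).
  exists (y - 1) => z /= uGz; rewrite leNgt; apply/negP => zy.
  have /yG /= : z < y by lra.
  by rewrite ltNge uGz.
apply/idP/idP => [Qx|]; last exact: ge_inf.
apply/negPn/negP; rewrite -ltNge => Gxu.
(* By right continuity [G < u] persists up to some [y > x], whereas [quantile G u <= x < y] puts a
   point of the set below [y]. *)
have /= : \forall y \near x^'+, G y < u.
  exact: (cvgr_lt _ (cumulative_is_right_continuous G x)).
move=> Gu; near x^'+ => y.
have [z /= uGz zy] : exists2 z, u <= G z & z < y.
  apply: (inf_lt Su); apply: (le_lt_trans Qx).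
  by near: y; exact: nbhs_right_gt.
have : G z <= G y by apply: cumulative_is_nondecreasing; exact: ltW.
have : G y < u by near: y.
lra.
Unshelve. all: by end_near. Qed.

Lemma quantile_nondecreasing G u v :
  0 < u -> u <= v -> v < 1 -> quantile G u <= quantile G v.
Proof.
move=> u0 uv v1; rewrite quantile_le; last by rewrite u0 (le_lt_trans uv).
by apply: (le_trans uv); rewrite -quantile_le// v1 (lt_le_trans u0).
Qed.

(** By monotonicity on []0, 1[], the preimages of closed rays are intervals. *)
Lemma measurable_quantile G : measurable_fun (`]0, 1[ : set R) (quantile G).
Proof.
apply: (measurability (@RGenCInfty.G R)) => [|/= _ [_ [r ->] <-]].
  exact: RGenCInfty.measurableE.
apply: is_interval_measurable => s t/=.
rewrite !in_itv/= !andbT => -[/andP[s0 s1] fs] [/andP[t0 t1] ft] u /andP[su ut].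
rewrite !in_itv/= andbT; split; first by apply/andP; split; lra.
by apply: (le_trans fs); apply: quantile_nondecreasing => //; lra.
Qed.

(* The transfer lemmas for pushforward measures require measurability on the
   whole line, which [quantile G] need not satisfy. *)
Let Q0 G := quantile G \_ (`]0, 1[ : set R).

Let measurable_Q0 G : measurable_fun setT (Q0 G).
Proof.
by apply/(measurable_restrictT _ _).1 => //; exact: measurable_quantile.
Qed.

Let ge0_integral_uniform01 (f : R -> \bar R) :
  measurable_fun setT f -> (forall x, 0 <= f x)%E ->
  (\int[uniform_prob (@ltr01 R)]_x f x = \int[mu]_(x in `]0%R, 1%R[) f x)%E.
Proof.
move=> mf f0; rewrite integral_uniform// subr0 invr1 mul1e.
by apply: integral_itv_bndoo; exact: measurable_funTS.
Qed.

Lemma cumulative_ge0 G x : 0 <= G x.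
Proof.
apply: (cvgr_to_le (cumulativeNy G)).
near=> y; apply: cumulative_is_nondecreasing.
by near: y; apply: nbhs_ninfty_le; rewrite num_real.
Unshelve. all: by end_near. Qed.

Lemma cumulative_le1 G x : G x <= 1.
Proof.
apply: (cvgr_to_ge (cumulativey G)).
near=> y; apply: cumulative_is_nondecreasing.
by near: y; apply: nbhs_pinfty_ge; rewrite num_real.
Unshelve. all: by end_near. Qed.

Lemma lebesgue_stieltjes_measure_itvoc (f : cumulative R R) (a b : R) :
  a <= b -> lebesgue_stieltjes_measure f `]a, b] = (f b - f a)%:E.
Proof.
move=> ab; rewrite /lebesgue_stieltjes_measure /measure_extension/=.
by rewrite measurable_mu_extE/=; [rewrite wlength_itv_bnd|exact: is_ocitv].
Qed.

(** It suffices to compare the two measures on intervals []a, b]]. By [quantile_le], the preimage of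
    such an interval within []0, 1[] is cut out by []G a, G b]]. *)
Lemma lebesgue_stieltjes_quantile G (A : set (measurableTypeR R)) :
  measurable A ->
  lebesgue_stieltjes_measure G A =
  pushforward (uniform_prob (@ltr01 R)) (Q0 G : R -> measurableTypeR R) A.
Proof.
move=> mA; apply: lebesgue_stieltjes_measure_unique => //=.
  exact: measurable_Q0.
move=> _ I [[a b]]/= _ <-.
have [ab|ba] := leP a b; last first.
  rewrite set_itv_ge ?bnd_simp -?leNgt ?ltW//.
  by rewrite /pushforward preimage_set0 !measure0.
rewrite lebesgue_stieltjes_measure_itvoc// /pushforward.
set B := _ @^-1` _.
have mB : measurable B by rewrite -[B]setTI; exact: measurable_Q0.
rewrite -[B in RHS]setIT -integral_indic// ge0_integral_uniform01//; last first.
  exact/measurable_EFinP/measurable_indic.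
rewrite integral_indic//.
have GaGb : G a <= G b by exact: cumulative_is_nondecreasing.
rewrite (_ : B `&` _ = `]G a, G b] `&` `]0, 1[); last first.
  apply/funext => u; apply/propext; split=> -[+ u01];
    rewrite /B/= /Q0 patchE mem_set//; move: (u01); rewrite /= !in_itv/= => ?;
    by rewrite !(ltNge a) !(ltNge (G a)) !quantile_le.
(* The intersection is squeezed between []G a, G b[], contained in []0, 1[] because [0 <= G a] and
   [G b <= 1], and []G a, G b]], which has the same measure. *)
have <- : mu `]G a, G b[ = (G b - G a)%:E.
  rewrite lebesgue_measure_itv/= lte_fin; case: ltP => //.
  by move=> GbGa; congr (_%:E); lra.
have le : (mu `]G a, G b] <= mu `]G a, G b[)%E.
  by rewrite !lebesgue_measure_itv.
apply/eqP; rewrite eq_le; apply/andP; split.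
  apply: le_measure; rewrite ?inE//; first exact: measurableI.
  move=> u /=; rewrite !in_itv/= => /andP[au ub].
  have := cumulative_ge0 G a; have := cumulative_le1 G b.
  by split; apply/andP; split; lra.
apply: (le_trans _ le); apply: le_measure; rewrite ?inE//.
exact: measurableI.
Qed.

(** Integrability is finiteness of the integral of the absolute value, which the pushforward by the
    quantile function carries from one side to the other. *)
Lemma finite_meanP G :
  finite_mean G <-> mu.-integrable `]0, 1[ (EFin \o quantile G).
Proof.
suff E : (\int[lebesgue_stieltjes_measure G]_x `|x%:E| =
          \int[mu]_(u in `]0%R, 1%R[) `|(quantile G u)%:E|)%E.
  rewrite /finite_mean; split => /integrableP[_ h]; apply/integrableP.
    by split; [apply/measurable_EFinP; exact: measurable_quantile|rewrite -E].
  by split; [exact/measurable_EFinP|rewrite E].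
rewrite (eq_measure_integral (pushforward (uniform_prob (@ltr01 R))
    (Q0 G : R -> measurableTypeR R))).
- exact: measurable_Q0.
- move=> mQ; transitivity (\int[uniform_prob (@ltr01 R)]_x `|(Q0 G x)%:E|)%E.
    rewrite (@ge0_integral_pushforward _ _ (measurableTypeR R)
      (measurableTypeR R) R (Q0 G) mQ (uniform_prob ltr01) setT
      (fun x : R => `|x%:E|%E))//.
    by do 2 exact/measurableT_comp.
  rewrite ge0_integral_uniform01//.
    by apply: eq_integral => u u01; rewrite /Q0 patchE u01.
  by apply/measurableT_comp => //; apply/measurable_EFinP; exact: measurable_Q0.
- by move=> mQ A mA _; exact: lebesgue_stieltjes_quantile.
Qed.

End quantile.

(** * Integration against Beta densities *)

Section beta.
Context {R : realType}.
Local Notation mu := (@lebesgue_measure R).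

Lemma ge0_integral_beta_prob (a b : nat) (U : set R) (f : R -> \bar R) :
  measurable U -> measurable_fun U f -> (forall x, 0 <= f x)%E ->
  (\int[beta_prob a b]_(x in U) f x =
   \int[mu]_(x in U) (f x * (beta_pdf a b x)%:E))%E.
Proof.
move=> mU mf f0.
have dom := @beta_prob_dom R a b.
rewrite -(Radon_Nikodym_SigmaFinite.change_of_variables dom)//.
have mpdf : measurable_fun U (EFin \o @beta_pdf R a b).
  by apply/measurable_EFinP/measurable_funTS; exact: measurable_beta_pdf.
have RNi : mu.-integrable U (Radon_Nikodym_SigmaFinite.f (beta_prob a b) mu).
  by apply: integrableS (Radon_Nikodym_SigmaFinite.f_integrable dom).
apply: ae_eq_integral => //.
- by apply: emeasurable_funM => //; exact: measurable_int RNi.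
- exact: emeasurable_funM.
(* The Radon-Nikodym derivative and [beta_pdf] have the same integral over every measurable subset
   of [U], hence agree almost everywhere. *)
- apply: ae_eqe_mul2l; apply: integral_ae_eq => // E EU mE.
  rewrite -Radon_Nikodym_SigmaFinite.f_integral//; exact/esym/integral_beta_pdf.
Qed.

(** The Beta density is bounded on [[0, 1]]. *)
Lemma integrable_beta_pdfr (a b : nat) (f : R -> R) :
  mu.-integrable `]0, 1[ (EFin \o f) ->
  mu.-integrable `]0, 1[ (EFin \o (fun x => f x * beta_pdf a b x)).
Proof.
move=> fi.
have := @integrableMl _ _ R mu (`]0, 1[ : set R) _ (EFin \o f)
  (beta_pdf a b) fi.
apply => //; first by apply: measurable_funTS; exact: measurable_beta_pdf.
have [M [Mr h]] := @bounded_beta_pdf_01 R a b.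
exists M; split => // x /h xM t/= /[!in_itv]/= /andP[t0 t1].
by apply: xM; rewrite /= in_itv/= !ltW.
Qed.

Lemma Rintegral_beta_prob (a b : nat) (f : R -> R) :
  mu.-integrable `]0, 1[ (EFin \o f) ->
  \int[beta_prob a b]_(x in `]0, 1[) f x =
  \int[mu]_(x in `]0, 1[) (f x * beta_pdf a b x).
Proof.
move=> fi; congr fine.
(* The change of density asks that [|f|] have a finite integral under [beta_prob]; the nonnegative
   case turns this integral into the Lebesgue integral of [|f * beta_pdf|]. *)
rewrite integral_beta_prob//; first exact: measurable_int fi.
rewrite ge0_integral_beta_prob//; last first.
  by apply/measurableT_comp => //; exact: measurable_int fi.
have /integrableP[_] := integrable_beta_pdfr a b fi.
congr (_ < _)%E; apply: eq_integral => x _ /=.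
by rewrite normrM EFinM (ger0_norm (beta_pdf_ge0 _ _ _)).
Qed.

Lemma Rintegral_beta_pdf01 (a b : nat) :
  \int[mu]_(x in `]0, 1[) beta_pdf a b x = 1.
Proof.
transitivity (fine (beta_prob (R:=R) a b `[0, 1])); last by rewrite beta_prob01.
rewrite -integral_beta_pdf//; congr fine; apply/esym/integral_itv_bndoo.
by apply/measurable_EFinP/measurable_funTS; exact: measurable_beta_pdf.
Qed.

(* The sign of this difference is that of [u - j / m], for [j = a.+1] and
   [m = a + b.+2]. *)
Lemma beta_pdf_diff (a b : nat) (u : R) : 0 < u < 1 ->
  beta_pdf a.+2 b.+1 u - beta_pdf a.+1 b.+2 u =
  u ^+ a * (1 - u) ^+ b / (beta_fun a.+1 b.+2 * a.+1%:R) *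
  ((a + b.+2)%:R * u - a.+1%:R).
Proof.
move=> /andP[u0 u1].
have u01 : u \in `[0, 1]%classic by rewrite inE/= in_itv/= !ltW.
(* Both normalising constants are expressed through [beta_fun a.+1 b.+2]; their ratio is
   [a.+1 / b.+1]. *)
rewrite /beta_pdf !patchE u01 /XMonemX/= beta_funSSnSm /unstable.onem.
have B0 := beta_fun_gt0 (R:=R) a.+1 b.+2.
rewrite !exprS; field.
by rewrite (gt_eqF B0)/= -!(natrD _ 1) !pnatr_eq0.
Qed.

End beta.

(** * Monotonicity of the mean order statistics *)

Section mean_order_stat.
Context {R : realType}.
Implicit Types G : cdfType R.
Local Notation mu := (@lebesgue_measure R).

Lemma mean_order_statE G (j m : nat) : finite_mean G ->
  mean_order_stat j m G =
  \int[mu]_(u in `]0, 1[) (quantile G u * beta_pdf j (m - j + 1) u).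
Proof.
by move=> /finite_meanP Gi; rewrite /mean_order_stat Rintegral_beta_prob.
Qed.

(** The index is [j = a.+1] and the sample size [m = a + b.+2], so that [j < m] is built in and the
    Beta parameters are successors. *)
Lemma mean_order_stat_leS G (a b : nat) : finite_mean G ->
  mean_order_stat a.+1 (a + b.+2) G <= mean_order_stat a.+2 (a + b.+2) G.
Proof.
move=> Gm; rewrite (mean_order_statE _ _ Gm) (mean_order_statE _ _ Gm).
have -> : (a + b.+2 - a.+1 + 1 = b.+2)%N by lia.
have -> : (a + b.+2 - a.+2 + 1 = b.+1)%N by lia.
have Qi := (finite_meanP G).1 Gm.
set m := (a + b.+2)%N.
(* The value of the quantile function at the point where the density difference changes sign. *)
set c := quantile G (a.+1%:R / m%:R).
have pi x y : mu.-integrable (`]0, 1[ : set R) (EFin \o beta_pdf x y).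
  by apply: (integrableS measurableT) => //; exact: integrable_beta_pdf.
have m0 : 0 < m%:R :> R by rewrite ltr0n /m; lia.
have Qp x y := integrable_beta_pdfr x y Qi.
rewrite -subr_ge0 -RintegralB//.
have dI : mu.-integrable (`]0, 1[ : set R)
    (EFin \o (fun u => beta_pdf a.+2 b.+1 u - beta_pdf a.+1 b.+2 u)).
  by apply: (@integrableB _ _ _ mu _ _ _ _ (pi _ _) (pi _ _)).
have cI : mu.-integrable (`]0, 1[ : set R)
    (EFin \o (fun u => c * (beta_pdf a.+2 b.+1 u - beta_pdf a.+1 b.+2 u))).
  exact: (@integrableZl _ _ R mu (`]0, 1[ : set R) (measurable_itv _) c _ dI).
have c0 : \int[mu]_(u in `]0, 1[)
    (c * (beta_pdf a.+2 b.+1 u - beta_pdf a.+1 b.+2 u)) = 0.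
  rewrite RintegralZl//.
  by rewrite RintegralB// !Rintegral_beta_pdf01 subrr mulr0.
have QI : mu.-integrable (`]0, 1[ : set R) (EFin \o
    (fun u => quantile G u * beta_pdf a.+2 b.+1 u -
              quantile G u * beta_pdf a.+1 b.+2 u)).
  by apply: (@integrableB _ _ _ mu _ _ _ _ (Qp _ _) (Qp _ _)).
(* Both densities have mass 1, so subtracting [c] times their difference costs nothing. The
   integrand becomes [quantile G u - c] times that difference, two factors of the same sign on each
   side of [j / m]. *)
rewrite -[X in 0 <= X]subr0 -[X in _ - X]c0 -RintegralB//.
apply: Rintegral_ge0 => u; rewrite /= in_itv/= => u01.
have [u0 u1] := andP u01.
rewrite -mulrBr -mulrBl beta_pdf_diff// mulrCA mulr_ge0//.
  by rewrite divr_ge0// mulr_ge0// ?exprn_ge0 ?beta_fun_ge0//; lra.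
have a1m : a.+1%:R < m%:R :> R by rewrite ltr_nat /m; lia.
have [au|ua] := leP a.+1%:R (m%:R * u).
  rewrite mulr_ge0// subr_ge0//; apply: quantile_nondecreasing => //.
    by rewrite divr_gt0.
  by rewrite ler_pdivrMr// mulrC.
rewrite mulr_le0// subr_le0; last exact: ltW.
apply: quantile_nondecreasing => //.
  by rewrite ler_pdivlMr// mulrC ltW.
by rewrite ltr_pdivrMr// mul1r.
Qed.

End mean_order_stat.

(** * Integrals of finite sums *)

Section sum.
Context d (T : measurableType d) (R : realType).
Context (mu : {measure set T -> \bar R}) (D : set T) (I : Type).
Context (f : I -> T -> R) (mD : measurable D).
Context (fi : forall i, mu.-integrable D (EFin \o f i)).

Lemma integrable_sumr (s : seq I) :
  mu.-integrable D (EFin \o (fun x => \sum_(i <- s) f i x)).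
Proof.
rewrite (_ : EFin \o _ = fun x => (\sum_(i <- s) (f i x)%:E)%E).
  by apply: integrable_sum => // i _; exact: fi.
by apply/funext => x; rewrite /= sumEFin.
Qed.

Lemma Rintegral_sum (s : seq I) :
  \int[mu]_(x in D) (\sum_(i <- s) f i x) =
  \sum_(i <- s) \int[mu]_(x in D) f i x.
Proof.
elim: s => [|i s ih].
  rewrite big_nil -[RHS](mul0r (fine (mu D))) -Rintegral_cst//.
  by apply: eq_Rintegral => x _; rewrite big_nil.
rewrite big_cons -ih -RintegralD//; last exact: integrable_sumr.
by apply: eq_Rintegral => x _; rewrite big_cons.
Qed.

End sum.

(** * The quantile function of the discretized distribution, cell by cell *)

Section discretization.
Context {R : realType}.
Implicit Types G : cdfType R.
Local Notation mu := (@lebesgue_measure R).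

Lemma le_mean_order_stat G (i j m : nat) : finite_mean G ->
  (0 < i)%N -> (i <= j <= m)%N ->
  mean_order_stat i m G <= mean_order_stat j m G.
Proof.
move=> Gm i0 /andP[ij jm].
(* The one-step inequality holds only for indices from 1 to [m], so the chain from [i] to [j] must
   stay in this range. *)
pose D : {pred nat} := [pred k | 0 < k <= m]%N.
pose f k := mean_order_stat k m G.
have fS : {in D, forall k, k.+1 \in D -> f k <= f k.+1}.
  move=> k /andP[k0 _] /andP[_]; rewrite -(prednK k0) => am.
  set a := k.-1 in am *.
  have := mean_order_stat_leS a (m - a.+2) Gm.
  rewrite (_ : (a + (m - a.+2).+2 = m)%N); first exact.
  by move: am; lia.
apply: (homo_leq_in (D := D) (f := f) (@lexx _ _)
  (fun _ _ _ => @le_trans _ _ _ _ _) _ fS).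
- by move=> a b aD bD k /andP[ak kb]; move: aD bD; rewrite !inE; lia.
- by rewrite inE i0 (leq_trans ij).
- by rewrite inE (leq_trans i0).
- exact: ij.
Qed.

(** The left-hand CDF counts the means that are at most [x]. Since they are nondecreasing in the
    index, the count is at least [j] if the [j]-th mean is at most [x], and at most [j - 1]
    otherwise; the bounds on [u] separate the two cases. *)
Lemma mean_order_stat_cdf_ge G (m : nat) (m_gt0 : (0 < m)%N) (j : nat)
    (u x : R) :
  finite_mean G -> (0 < j <= m)%N -> (j%:R - 1) / m%:R < u <= j%:R / m%:R ->
  (u <= mean_order_stat_cdf m_gt0 G x) = (mean_order_stat j m G <= x).
Proof.
move=> Gm /andP[j0 jm] /andP[ju uj].
have m0 : 0 < m%:R :> R by rewrite ltr0n.
rewrite mean_order_stat_cdfE mulrC.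
apply/idP/idP => [|jx].
  apply: contraTT; rewrite -!ltNge => xj; apply: le_lt_trans ju.
  rewrite ler_pM2r ?invr_gt0// (big_cat_nat (n := j))//=; last exact: leqW.
  rewrite [X in _ + X](_ : _ = 0) ?addr0; last first.
    rewrite big_nat big1// => i /andP[ji im].
    have ij : mean_order_stat j m G <= mean_order_stat i m G.
      by apply: le_mean_order_stat; rewrite // ji.
    by rewrite leNgt (lt_le_trans xj ij).
  apply: (@le_trans _ _ (\sum_(1 <= i < j) 1)).
    by apply: ler_sum => i _; rewrite lern1; case: (_ <= _).
  by rewrite sumr_const_nat natrB.
apply: (le_trans uj).
rewrite ler_pM2r ?invr_gt0// (big_cat_nat (n := j.+1))//=.
rewrite (eq_big_nat _ _ (F2 := fun=> 1)); last first.
  move=> i /andP[i0 ij].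
  have ji : mean_order_stat i m G <= mean_order_stat j m G.
    by apply: le_mean_order_stat; rewrite // -ltnS ij.
  by rewrite (le_trans ji jx).
by rewrite sumr_const_nat subn1/= lerDl sumr_ge0.
Qed.

Lemma quantile_mean_order_stat_cdf G (m : nat) (m_gt0 : (0 < m)%N) (j : nat)
    (u : R) :
  finite_mean G -> (0 < j <= m)%N -> (j%:R - 1) / m%:R < u <= j%:R / m%:R ->
  quantile (mean_order_stat_cdf m_gt0 G) u = mean_order_stat j m G.
Proof.
move=> Gm j0m uj; rewrite /quantile -[RHS](@inf_itv R +oo%O true)//; congr inf.
apply/seteqP; split => x /=; rewrite in_itv/= andbT;
  by rewrite (mean_order_stat_cdf_ge m_gt0 _ Gm j0m uj).
Qed.

Lemma cell_exists (m : nat) (u : R) : (0 < m)%N -> 0 < u < 1 ->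
  exists2 j : nat, (0 < j <= m)%N & (j%:R - 1) / m%:R < u <= j%:R / m%:R.
Proof.
move=> m_gt0 /andP[u0 u1].
have m0 : 0 < m%:R :> R by rewrite ltr0n.
have uE : exists n : nat, u <= n%:R / m%:R.
  by exists m; rewrite divff ?gt_eqF// ltW.
(* The cell is the one of the least [n] with [u <= n / m]; [u > 0] excludes [n = 0], and minimality
   gives the strict lower bound. *)
case: (ex_minnP uE) => -[|j] uj jmin.
  by move: uj; rewrite mul0r leNgt u0.
exists j.+1.
  by apply: jmin; rewrite divff ?gt_eqF// ltW.
rewrite uj andbT ltNge; apply/negP => uj'; have := jmin j.
rewrite -natr1 addrK in uj' => /(_ uj').
by rewrite ltnn.
Qed.

Lemma cell_unique (m i j : nat) (u : R) : (0 < m)%N ->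
  (i%:R - 1) / m%:R < u <= i%:R / m%:R ->
  (j%:R - 1) / m%:R < u <= j%:R / m%:R -> i = j.
Proof.
move=> m_gt0.
have m0 : 0 < m%:R :> R by rewrite ltr0n.
rewrite !ltr_pdivrMr// !ler_pdivlMr// => /andP[i1 i2] /andP[j1 j2].
apply/eqP; rewrite eqn_leq; apply/andP; split.
  by rewrite -ltnS -(ltr_nat R) -natr1; lra.
by rewrite -ltnS -(ltr_nat R) -natr1; lra.
Qed.

(** Cells closed on the right partition []0, 1[] exactly, while [P_op] integrates over open ones;
    they differ by a null endpoint. *)
Lemma Rintegral_cell (w : R -> R) (m j : nat) : L1_01 w -> (0 < j <= m)%N ->
  \int[mu]_(t in `]0, 1[) (w \_ `](j%:R - 1) / m%:R, j%:R / m%:R]) t =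
  \int[mu]_(t in `](j%:R - 1) / m%:R, j%:R / m%:R[) w t.
Proof.
move=> wi /andP[j0 jm].
have m0 : 0 < m%:R :> R by rewrite ltr0n (leq_trans j0).
rewrite -Rintegral_mkcondr.
have a0 : 0 <= (j%:R - 1) / m%:R :> R by rewrite divr_ge0// subr_ge0 ler1n.
have : j%:R / m%:R <= 1 :> R by rewrite ler_pdivrMr// mul1r ler_nat.
move: a0; set a := (_ - 1) / _; set b := j%:R / _; move: a b => a b a0 b1.
(* For the last cell, intersecting with []0, 1[] already removes the right endpoint; for the others
   it stays and is dropped as a null set. *)
have [b_1|b_1] := eqVneq b 1.
  congr Rintegral; apply/seteqP; split => u /=; rewrite !in_itv/=.
    by move=> [/andP[u0 u1] /andP[au ub]]; rewrite au b_1.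
  by move=> /andP[au ub]; split; apply/andP; split; lra.
rewrite Rintegral_itv_bndo_bndc; last first.
  apply: integrableS wi => // u /=; rewrite !in_itv/= => /andP[au ub].
  by apply/andP; split; lra.
have {b_1} b_1 : b < 1 by rewrite lt_neqAle b_1.
congr Rintegral; apply/seteqP; split => u /=; rewrite !in_itv/=; first by case.
by move=> /andP[au ub]; split; apply/andP; split; lra.
Qed.

(** Exactly one cell contains [u], so a single term of the sum survives. *)
Lemma quantile_mean_order_stat_cdfM G (m : nat) (m_gt0 : (0 < m)%N)
    (w : R -> R) (u : R) : finite_mean G -> 0 < u < 1 ->
  quantile (mean_order_stat_cdf m_gt0 G) u * w u =
  \sum_(1 <= j < m.+1) mean_order_stat j m G *
    (w \_ `](j%:R - 1) / m%:R, j%:R / m%:R]) u.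
Proof.
move=> Gm u01; have [j jm uj] := cell_exists m_gt0 u01.
rewrite (quantile_mean_order_stat_cdf m_gt0 Gm jm uj).
rewrite (bigD1_seq j) ?mem_index_iota ?iota_uniq//= patchE.
rewrite mem_set/=; last by rewrite in_itv/=.
rewrite big1 ?addr0// => i ij; rewrite patchE memNset ?mulr0//= in_itv/= => ui.
by move/eqP : ij; apply; exact: cell_unique ui uj.
Qed.

Lemma integrable_cell (w : R -> R) (a b : R) : L1_01 w ->
  mu.-integrable `]0, 1[ (EFin \o (w \_ `]a, b])).
Proof.
move=> wi; rewrite -restrict_EFin; apply/integrable_restrict => //.
by apply: integrableS wi => //; exact: measurableI.
Qed.

Lemma L1_01Zl (k : R) (w : R -> R) : L1_01 w -> L1_01 (fun u => k * w u).
Proof.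
move=> wi.
exact: (@integrableZl _ _ R mu (`]0, 1[ : set R) (measurable_itv _) k
  (EFin \o w)).
Qed.

Lemma L1_01_sum (I : Type) (s : seq I) (f : I -> R -> R) :
  (forall i, L1_01 (f i)) -> L1_01 (fun u => \sum_(i <- s) f i u).
Proof.
by move=> fi; exact: (@integrable_sumr _ _ R mu (`]0, 1[ : set R) I f
  (measurable_itv _) fi s).
Qed.

Lemma eq_L1_01 (f g : R -> R) : (forall u, 0 < u < 1 -> f u = g u) ->
  L1_01 f -> L1_01 g.
Proof.
by move=> fg; apply: eq_integrable => // u; rewrite inE/= in_itv/= => /fg ->.
Qed.

Lemma L1_01_cst (k : R) : L1_01 (fun=> k).
Proof.
apply: measurable_bounded_integrable => //.
  by rewrite /= lebesgue_measure_itv/= lte01 sube0 ltry.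
by exists `|k|; split => // x kx ? _; exact: ltW.
Qed.

Lemma L1_01_quantile_mean_order_stat_cdfM G (m : nat) (m_gt0 : (0 < m)%N)
    (w : R -> R) : finite_mean G -> L1_01 w ->
  L1_01 (fun u => quantile (mean_order_stat_cdf m_gt0 G) u * w u).
Proof.
move=> Gm wi; apply: (@eq_L1_01 (fun u => \sum_(j <- index_iota 1 m.+1)
    mean_order_stat j m G * (w \_ `](j%:R - 1) / m%:R, j%:R / m%:R]) u)).
  by move=> u u01; rewrite quantile_mean_order_stat_cdfM.
by apply: L1_01_sum => j; apply: L1_01Zl; exact: integrable_cell.
Qed.

(** This is the weighted integrability at the constant weight 1, read through [finite_meanP]. *)
Lemma finite_mean_mean_order_stat_cdf G (m : nat) (m_gt0 : (0 < m)%N) :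
  finite_mean G -> finite_mean (mean_order_stat_cdf m_gt0 G).
Proof.
move=> Gm; apply/finite_meanP.
apply: eq_L1_01 (L1_01_quantile_mean_order_stat_cdfM m_gt0 Gm (L1_01_cst 1)).
by move=> u _; rewrite mulr1.
Qed.

End discretization.

(** * Term-by-term comparison of the two functionals *)

Theorem theorem3 (R : realType) (m : nat) (m_gt0 : (0 < m)%N)
    (w : R -> R) (w_L1 : L1_01 w)
    (G : cdfType R) (G_mean : finite_mean G) :
  [/\ in_Lfunctional_domain w (mean_order_stat_cdf m_gt0 G),
      in_Lfunctional_domain (P_op m w) G &
      Lfunctional w (mean_order_stat_cdf m_gt0 G) = Lfunctional (P_op m w) G].
Proof.
have Qi := (finite_meanP G).1 G_mean.
pose c j : R :=
  \int[lebesgue_measure]_(t in `](j%:R - 1) / m%:R, j%:R / m%:R[) w t.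
have QPE u : quantile G u * P_op m w u =
    \sum_(1 <= j < m.+1) c j * (quantile G u * beta_pdf j (m - j + 1) u).
  by rewrite mulr_sumr; apply: eq_bigr => j _; rewrite mulrA mulrC.
have Qpi j : L1_01 (fun u => quantile G u * beta_pdf j (m - j + 1) u).
  exact: integrable_beta_pdfr.
split.
- split; first exact: finite_mean_mean_order_stat_cdf.
  exact: L1_01_quantile_mean_order_stat_cdfM.
- split; first exact: G_mean.
  apply: (@eq_L1_01 _ (fun u => \sum_(j <- index_iota 1 m.+1)
      c j * (quantile G u * beta_pdf j (m - j + 1) u))) => [u _|].
    by rewrite QPE.
  by apply: L1_01_sum => j; exact: L1_01Zl.
- rewrite /Lfunctional; under [RHS]eq_Rintegral do rewrite QPE.
  transitivity (\int[lebesgue_measure]_(u in `]0, 1[) \sum_(1 <= j < m.+1)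
      mean_order_stat j m G * (w \_ `](j%:R - 1) / m%:R, j%:R / m%:R]) u).
    apply: eq_Rintegral => u; rewrite inE/= in_itv/= => u01.
    exact: quantile_mean_order_stat_cdfM.
  rewrite Rintegral_sum//; last first.
    by move=> j; apply: L1_01Zl; exact: integrable_cell.
  rewrite Rintegral_sum//; last by move=> j; exact: L1_01Zl.
  (* On both sides the [j]-th term is the [j]-th mean times [c j]: on the left [c j] comes from
     integrating [w] over the cell, on the right the mean comes from the Beta integral. *)
  apply: eq_big_nat => j jm.
  rewrite RintegralZl//; last exact: integrable_cell.
  rewrite Rintegral_cell// RintegralZl//; last exact: Qpi.
  by rewrite mean_order_statE// mulrC.
Qed.
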